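(* For each integer $r$ and each non-negative integer $n$, \[ \sum_{k = 0}^n \binom {2k}{k} \binom {2(n - k)}{n-k}5^{n - k} F_{6k + r} = 4^n \sum_{k = 0}^n \binom nk^2 4^k F_{2k + r}, \qquad \sum_{k = 0}^n \binom {2k}{k} \binom {2(n - k)}{n-k}5^{n - k} L_{6k + r} = 4^n \sum_{k = 0}^n \binom nk^2 4^k L_{2k + r}. \]
   Context: $F_j$ and $L_j$ denote the Fibonacci and Lucas numbers: $F_0=0,F_1=1$, $L_0=2,L_1=1$, both satisfying $X_j=X_{j-1}+X_{j-2}$, extended to all integer indices via the recurrence (so $F_{-j}=(-1)^{j+1}F_j$, $L_{-j}=(-1)^jL_j$). *)

(* Defs.v *)
From mathcomp Require Import all_boot all_order all_algebra.
From mathcomp Require Import zify ring.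

Set Implicit Arguments.
Unset Strict Implicit.
Unset Printing Implicit Defensive.

Import Order.TTheory GRing.Theory Num.Theory.
Local Open Scope ring_scope.

(* The pair (X_j, X_(j+1)) shifted by one index in either direction. *)
Definition rec_next (p : int * int) : int * int := (p.2, p.1 + p.2).
Definition rec_prev (p : int * int) : int * int := (p.2 - p.1, p.1).

(* The two-sided solution of X_j = X_(j-1) + X_(j-2) with X_0 = a, X_1 = b;
   recall that Negz m is the integer -(m+1). *)
Definition recseq (a b j : int) : int :=
  match j with
  | Posz m => (iter m rec_next (a, b)).1
  | Negz m => (iter m.+1 rec_prev (a, b)).1
  end.

Definition fib (j : int) : int := recseq 0 1 j.
Definition lucas (j : int) : int := recseq 2 1 j.

Lemma fib0 : fib 0 = 0. Proof. by []. Qed.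
Lemma fib1 : fib 1 = 1. Proof. by []. Qed.
Lemma lucas0 : lucas 0 = 2. Proof. by []. Qed.
Lemma lucas1 : lucas 1 = 1. Proof. by []. Qed.

Lemma recseqE (a b j : int) :
  recseq a b j = recseq a b (j - 1) + recseq a b (j - 2).
Proof.
case: j => [[|[|m]]|m].
- by rewrite /recseq /= ; ring.
- by rewrite /recseq /= ; ring.
- have -> : Posz m.+2 - 1 = Posz m.+1 by lia.
  have -> : Posz m.+2 - 2 = Posz m by lia.
  by rewrite /recseq !iterS /= addrC.
- have -> : Negz m - 1 = Negz m.+1 by lia.
  have -> : Negz m - 2 = Negz m.+2 by lia.
  by rewrite /recseq !iterS /=; ring.
Qed.

Lemma fibE (j : int) : fib j = fib (j - 1) + fib (j - 2).
Proof. exact: recseqE. Qed.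

Lemma lucasE (j : int) : lucas j = lucas (j - 1) + lucas (j - 2).
Proof. exact: recseqE. Qed.

Lemma fibN (m : nat) : fib (- m%:Z) = (-1) ^+ m.+1 * fib m%:Z.
Proof.
suff [] : fib (- m%:Z) = (-1) ^+ m.+1 * fib m%:Z /\
          fib (- m.+1%:Z) = (-1) ^+ m.+2 * fib m.+1%:Z by [].
elim: m => [|m [IH0 IH1]]; first by split.
split=> //; have := fibE (- m%:Z); have := fibE m.+2%:Z.
have -> : m.+2%:Z - 1 = m.+1%:Z by lia.
have -> : m.+2%:Z - 2 = m%:Z by lia.
have -> : - m%:Z - 1 = - m.+1%:Z by lia.
have -> : - m%:Z - 2 = - m.+2%:Z by lia.
move=> -> e; have -> : fib (- m.+2%:Z) = fib (- m%:Z) - fib (- m.+1%:Z).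
  by rewrite [fib (- m%:Z)]e; ring.
by rewrite IH0 IH1 !exprS; ring.
Qed.

Lemma lucasN (m : nat) : lucas (- m%:Z) = (-1) ^+ m * lucas m%:Z.
Proof.
suff [] : lucas (- m%:Z) = (-1) ^+ m * lucas m%:Z /\
          lucas (- m.+1%:Z) = (-1) ^+ m.+1 * lucas m.+1%:Z by [].
elim: m => [|m [IH0 IH1]]; first by split.
split=> //; have := lucasE (- m%:Z); have := lucasE m.+2%:Z.
have -> : m.+2%:Z - 1 = m.+1%:Z by lia.
have -> : m.+2%:Z - 2 = m%:Z by lia.
have -> : - m%:Z - 1 = - m.+1%:Z by lia.
have -> : - m%:Z - 2 = - m.+2%:Z by lia.
move=> -> e; have -> : lucas (- m.+2%:Z) = lucas (- m%:Z) - lucas (- m.+1%:Z).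
  by rewrite [lucas (- m%:Z)]e; ring.
by rewrite IH0 IH1 !exprS; ring.
Qed.

(* Main.v *)
Require Import Defs.
From mathcomp Require Import all_boot all_order all_algebra.
From mathcomp Require Import all_field zify ring.
Import Order.TTheory GRing.Theory Num.Theory.
Local Open Scope ring_scope.

(** Let [phi] be a root of [X^2 = X + 1] and [w = 2 * phi]. Then
    [(1 + w)^2 = phi^6] and [(1 - w)^2 = 5], so by Binet's formula both
    identities are instances of
    [\sum_k C(2k,k) C(2(n-k),n-k) (1+w)^(2k) (1-w)^(2(n-k))
       = 4^n \sum_k C(n,k)^2 w^(2k)].
    Both sides of this satisfy the recurrence of the (rescaled) Legendre
    polynomials: the generating function of
    [\sum_k C(2k,k) C(2(n-k),n-k) x^k y^(n-k)] is
    [((1 - 4xt)(1 - 4yt))^(-1/2)]. *)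

(** * Relations between neighbouring binomial coefficients *)

Lemma central_binS (k : nat) :
  (k.+1 * 'C(2 * k.+1, k.+1) = (4 * k + 2) * 'C(2 * k, k))%N.
Proof.
have h1 := mul_bin_diag (2 * k.+1) k.
have h2 := mul_bin_down (2 * k).+1 k.
have e : ((2 * k.+1).-1 = (2 * k).+1)%N by lia.
rewrite e in h1.
have e2 : ((2 * k).+1 - k = k.+1)%N by lia.
rewrite e2 /= in h2.
nia.
Qed.

Lemma bin_right (n k : nat) :
  k.+1%:Z * 'C(n, k.+1)%:Z = (n%:Z - k%:Z) * 'C(n, k)%:Z.
Proof.
case: (leqP k n) => [le_kn | lt_nk]; last by rewrite !bin_small ?mulr0 //; lia.
by rewrite subzn // -!PoszM mul_bin_left.
Qed.

(* A product form of [C(n,k), C(n,k+1), C(n,k+2)] being in hypergeometric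
   progression. *)
Lemma bin_three_term (n k : nat) (a := 'C(n, k)%:Z) (b := 'C(n, k.+1)%:Z)
    (c := 'C(n, k.+2)%:Z) :
  (n%:Z + 2) * a * c + a * b + b * c = n%:Z * b ^+ 2.
Proof.
have hb : k.+1%:Z * b = (n%:Z - k%:Z) * a by exact: bin_right.
have hc : k.+2%:Z * c = (n%:Z - k.+1%:Z) * b by exact: bin_right.
case: (leqP n k) => [le_nk | lt_kn].
  have -> : b = 0 by rewrite /b bin_small.
  have -> : c = 0 by rewrite /c bin_small //; lia.
  ring.
(* Multiplying by this factor, nonzero as [k < n], lets [hb] and [hc] express every term through [b]
   alone. *)
have d0 : (n%:Z - k%:Z) * k.+2%:Z != 0 by rewrite mulf_eq0; lia.
apply: (mulfI d0).
have -> : (n%:Z - k%:Z) * k.+2%:Z * ((n%:Z + 2) * a * c + a * b + b * c) =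
  (n%:Z + 2) * ((n%:Z - k%:Z) * a) * (k.+2%:Z * c) +
  k.+2%:Z * b * ((n%:Z - k%:Z) * a) +
  (n%:Z - k%:Z) * b * (k.+2%:Z * c) by ring.
rewrite -hb hc !intS; ring.
Qed.

(** * Convolution of central binomial coefficients *)

Section CentralConvolution.

Context {R : comNzRingType}.
Implicit Types x y z : R.

Definition central_term x y (n k : nat) : R :=
  'C(2 * k, k)%:R * 'C(2 * (n - k), n - k)%:R * x ^+ k * y ^+ (n - k).

Definition central_conv x y (n : nat) : R :=
  \sum_(0 <= k < n.+1) central_term x y n k.

(** This sum and [central_conv_r] are the images of [central_conv] under the Euler operators
    [x d/dx] and [y d/dy]; each satisfies a first-order recurrence. *)
Definition central_conv_l x y (n : nat) : R :=
  \sum_(0 <= k < n.+1) k%:R * central_term x y n k.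

Definition central_conv_r x y (n : nat) : R :=
  \sum_(0 <= k < n.+1) (n - k)%:R * central_term x y n k.

Lemma central_conv_lr x y n :
  central_conv_l x y n + central_conv_r x y n = n%:R * central_conv x y n.
Proof.
rewrite -big_split mulr_sumr; apply: eq_big_nat => k /andP[_ le_kn] /=.
by rewrite -mulrDl -natrD subnKC.
Qed.

Lemma central_binSr k :
  k.+1%:R * 'C(2 * k.+1, k.+1)%:R = (4 * k%:R + 2) * 'C(2 * k, k)%:R :> R.
Proof. by rewrite -natrM central_binS natrM natrD natrM. Qed.

(** The term [k = 0] vanishes, and the weight [k.+1] is absorbed by the ratio of consecutive central
    binomials. *)
Lemma central_conv_lS x y n :
  central_conv_l x y n.+1 =
  4 * x * central_conv_l x y n + 2 * x * central_conv x y n.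
Proof.
rewrite {1}/central_conv_l big_nat_recl // mul0r add0r !mulr_sumr -big_split.
apply: eq_big_nat => k _ /=; rewrite /central_term subSS !mulrA central_binSr.
by rewrite exprS; ring.
Qed.

Lemma central_conv_rS x y n :
  central_conv_r x y n.+1 =
  4 * y * central_conv_r x y n + 2 * y * central_conv x y n.
Proof.
rewrite {1}/central_conv_r big_nat_recr //= subnn mul0r addr0.
rewrite !mulr_sumr -big_split.
apply: eq_big_nat => k /andP[_ le_kn] /=; rewrite /central_term subSn //.
set m := (n - k)%N.
transitivity (m.+1%:R * 'C(2 * m.+1, m.+1)%:R * 'C(2 * k, k)%:R * x ^+ k
              * y ^+ m.+1); first by ring.
by rewrite central_binSr exprS; ring.
Qed.

(** Write [S], [l], [r] for the three sums. The first-order recurrences produce [4xl + 4yr], which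
    is [4(x+y)(l+r)] minus the cross terms [4yl + 4xr]; unfolding these once more gives
    [16xy(l+r+S)] at level [n], and [l + r = nS]. *)
Lemma central_conv_rec x y n :
  n.+2%:R * central_conv x y n.+2 =
  (4 * n.+1%:R + 2) * (x + y) * central_conv x y n.+1
  - 16 * (x * y) * n.+1%:R * central_conv x y n.
Proof.
have h := central_conv_lr x y n; have h1 := central_conv_lr x y n.+1.
rewrite -central_conv_lr central_conv_lS central_conv_rS.
have -> : (4 * n.+1%:R + 2) * (x + y) * central_conv x y n.+1 =
    4 * (x + y) * (n.+1%:R * central_conv x y n.+1)
    + 2 * (x + y) * central_conv x y n.+1 by ring.
have -> : 16 * (x * y) * n.+1%:R * central_conv x y n =
    16 * (x * y) * (n%:R * central_conv x y n + central_conv x y n).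
  by rewrite -natr1; ring.
rewrite -h -h1 central_conv_lS central_conv_rS; ring.
Qed.

(** * Legendre recurrence for squared binomials *)

(** Classically [(1 - X)^n P_n((1 + X)/(1 - X))], with [P_n] the Legendre polynomial. *)
Definition sqbin_poly (n : nat) : {poly R} :=
  \poly_(k < n.+1) ('C(n, k) ^ 2)%:R.

Lemma coef_sqbin_poly n k : (sqbin_poly n)`_k = ('C(n, k) ^ 2)%:R.
Proof. by rewrite coef_poly ltnS; case: leqP => // /bin_small->. Qed.

Lemma horner_sqbin_poly n z :
  (sqbin_poly n).[z] = \sum_(0 <= k < n.+1) ('C(n, k) ^ 2)%:R * z ^+ k.
Proof. by rewrite horner_poly big_mkord. Qed.

Lemma sqbin_rec n k :
  (n%:Z + 2) * 'C(n.+2, k.+2)%:Z ^+ 2 =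
  (2 * n%:Z + 3) * ('C(n.+1, k.+2)%:Z ^+ 2 + 'C(n.+1, k.+1)%:Z ^+ 2)
  - (n%:Z + 1) * ('C(n, k.+2)%:Z ^+ 2 - 2 * 'C(n, k.+1)%:Z ^+ 2
                  + 'C(n, k)%:Z ^+ 2).
Proof.
have h := bin_three_term n k.
rewrite !binS !PoszD.
apply/eqP; rewrite -subr_eq0; apply/eqP.
(* After Pascal's rule, the two sides differ by twice the defect of [bin_three_term]. *)
transitivity (2 * (((n%:Z + 2) * 'C(n, k)%:Z * 'C(n, k.+2)%:Z
   + 'C(n, k)%:Z * 'C(n, k.+1)%:Z + 'C(n, k.+1)%:Z * 'C(n, k.+2)%:Z)
   - n%:Z * 'C(n, k.+1)%:Z ^+ 2)); first by ring.
by rewrite h subrr mulr0.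
Qed.

Lemma sqbin_poly_rec n :
  n.+2%:R *: sqbin_poly n.+2 =
  (2 * n.+1%:R + 1) *: (sqbin_poly n.+1 + sqbin_poly n.+1 * 'X)
  - n.+1%:R *: (sqbin_poly n - 2 *: (sqbin_poly n * 'X)
                + sqbin_poly n * 'X * 'X).
Proof.
apply/polyP=> k.
rewrite !(coefZ, coefB, coefD, coefMX, coef_sqbin_poly).
(* In degrees 0 and 1 some shifted coefficients are absent; from degree 2 on this is [sqbin_rec]
   mapped into [R]. *)
case: k => [|[|k]] /=.
- by rewrite !bin0 -!natr1; ring.
- rewrite !bin1 !bin0 !natrX -!natr1; ring.
have := congr1 (intmul (1 : R)) (sqbin_rec n k).
rewrite !(intrM, intrB, intrD, rmorphXn) !natrX -!natr1 => h.
by apply: etrans (etrans h _); ring.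
Qed.

Lemma sqbin_horner_rec n z :
  n.+2%:R * (sqbin_poly n.+2).[z] =
  (2 * n.+1%:R + 1) * (1 + z) * (sqbin_poly n.+1).[z]
  - n.+1%:R * (1 - z) ^+ 2 * (sqbin_poly n).[z].
Proof.
by rewrite -hornerZ sqbin_poly_rec !(hornerZ, hornerD, hornerN, hornerMX); ring.
Qed.

End CentralConvolution.

(** * Comparison of the two sums *)

(** Here [x + y = 2(1 + w^2)] and [xy = (1 - w^2)^2], so the factor [4^n] matches the two
    recurrences. *)
Lemma central_conv_sqr {R : numDomainType} (w : R) (n : nat) :
  central_conv ((1 + w) ^+ 2) ((1 - w) ^+ 2) n =
  4 ^+ n * (sqbin_poly n).[w ^+ 2].
Proof.
set x := (1 + w) ^+ 2; set y := (1 - w) ^+ 2.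
suff [] : central_conv x y n = 4 ^+ n * (sqbin_poly n).[w ^+ 2] /\
  central_conv x y n.+1 = 4 ^+ n.+1 * (sqbin_poly n.+1).[w ^+ 2] by [].
elim: n => [|n [IH0 IH1]].
  rewrite !horner_sqbin_poly /central_conv /central_term.
  rewrite !(big_nat1, big_nat_recr) //=.
  by rewrite /x /y /binomial /=; split; ring.
split=> //; have n0 : n.+2%:R != 0 :> R by rewrite pnatr_eq0.
apply: (mulfI n0); rewrite central_conv_rec IH0 IH1 [RHS]mulrCA sqbin_horner_rec.
by rewrite /x /y !exprS; ring.
Qed.

Lemma golden_central_conv {R : numDomainType} {phi : R} (n : nat) :
    phi ^+ 2 = phi + 1 ->
  central_conv (phi ^+ 6) 5 n =
  4 ^+ n * \sum_(0 <= k < n.+1) ('C(n, k) ^ 2)%:R * 4 ^+ k * phi ^+ (2 * k).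
Proof.
move=> phi2; have := central_conv_sqr (2 * phi) n; rewrite horner_sqbin_poly.
(* Indeed [phi^3 = 2 phi + 1]. *)
have -> : (1 + 2 * phi) ^+ 2 = phi ^+ 6.
  by ring: phi2.
have -> : (1 - 2 * phi) ^+ 2 = 5.
  by ring: phi2.
move->; congr (_ * _); apply: eq_bigr => k _.
have -> : (2 * phi) ^+ 2 = 4 * phi ^+ 2 by ring.
by rewrite exprMn -exprM mulrA.
Qed.

(** * Binet's formula at all integer indices *)

Lemma golden_neq0 {F : fieldType} {u : F} : u ^+ 2 = u + 1 -> u != 0.
Proof.
move=> u2; apply/eqP=> u0; move: u2.
by rewrite u0 expr0n add0r => /esym/eqP; rewrite oner_eq0.
Qed.

Lemma golden_inv {F : fieldType} {u : F} : u ^+ 2 = u + 1 -> u^-1 = u - 1.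
Proof.
move=> u2; have u0 := golden_neq0 u2; apply: (mulfI u0).
by rewrite mulfV // mulrBr mulr1 -expr2 u2 addrC addKr.
Qed.

Section Binet.

Context {F : fieldType} {phi psi : F}.
Hypotheses (phi2 : phi ^+ 2 = phi + 1) (psi2 : psi ^+ 2 = psi + 1).
Hypothesis phiBpsi : phi - psi != 0.

Lemma recseq_binet (a b : int) :
  exists A B : F, forall j : int,
    (recseq a b j)%:~R = A * phi ^ j + B * psi ^ j.
Proof.
(* Solution of the linear system [A + B = a], [A phi + B psi = b]. *)
pose A := (b%:~R - a%:~R * psi) / (phi - psi).
pose B := (a%:~R * phi - b%:~R) / (phi - psi).
exists A, B.
have AB0 : a%:~R = A + B by rewrite /A /B; field.
have AB1 : b%:~R = A * phi + B * psi by rewrite /A /B; field.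
case=> m.
  suff [] : (iter m rec_next (a, b)).1%:~R = A * phi ^+ m + B * psi ^+ m /\
    (iter m rec_next (a, b)).2%:~R = A * phi ^+ m.+1 + B * psi ^+ m.+1 by [].
  elim: m => [|m [IH0 IH1]]; first by rewrite !mulr1 !expr1.
  rewrite iterS /= IH1 rmorphD /= IH0 IH1; split=> //.
  by rewrite -[m.+2]addn2 !exprD phi2 psi2 !exprS; ring.
rewrite /recseq !NegzE -!exprnN -!exprVn.
(* The second component sits one index higher, hence the extra factors [phi] and [psi]. A backward
   step holds because [u^-1 = u - 1]. *)
suff [] : (iter m.+1 rec_prev (a, b)).1%:~R =
      A * phi^-1 ^+ m.+1 + B * psi^-1 ^+ m.+1 /\
    (iter m.+1 rec_prev (a, b)).2%:~R =
      A * phi * phi^-1 ^+ m.+1 + B * psi * psi^-1 ^+ m.+1 by [].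
elim: m.+1 => {m} [|m [IH0 IH1]]; first by rewrite !mulr1.
rewrite iterS /= rmorphB /= IH0 IH1 !exprS; split.
  by rewrite !golden_inv //; ring.
by rewrite !mulrA !mulfK ?golden_neq0.
Qed.

End Binet.

Lemma golden_roots :
  exists phi psi : algC,
    [/\ phi ^+ 2 = phi + 1, psi ^+ 2 = psi + 1 & phi - psi != 0].
Proof.
have s5 : sqrtC 5 ^+ 2 = 5 :> algC by rewrite sqrtCK.
exists ((1 + sqrtC 5) / 2), ((1 - sqrtC 5) / 2); split.
- by field: s5.
- by field: s5.
rewrite (_ : _ - _ = sqrtC 5); last by field.
by rewrite sqrtC_eq0 pnatr_eq0.
Qed.

(** Both sides are linear in the sequence, so it suffices to combine [golden_central_conv] at the
    two roots with weights [A phi^r] and [B psi^r]. *)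
Lemma recseq_central_conv (a b r : int) (n : nat) :
  \sum_(0 <= k < n.+1)
      'C(2 * k, k)%:Z * 'C(2 * (n - k), n - k)%:Z * 5 ^+ (n - k)
        * recseq a b (6 * k%:Z + r)
   = 4 ^+ n * \sum_(0 <= k < n.+1)
      'C(n, k)%:Z ^+ 2 * 4 ^+ k * recseq a b (2 * k%:Z + r).
Proof.
have [phi [psi [phi2 psi2 phiBpsi]]] := golden_roots.
have [A [B binet]] := recseq_binet phi2 psi2 phiBpsi a b.
have shift (u : algC) (d k : nat) : u ^+ 2 = u + 1 ->
    u ^ (d%:Z * k%:Z + r) = u ^+ (d * k) * u ^ r.
  by move=> /golden_neq0 u0; rewrite expfzDr.
have hphi := golden_central_conv n phi2; have hpsi := golden_central_conv n psi2.
apply: (@intr_inj algC).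
transitivity (A * phi ^ r * central_conv (phi ^+ 6) 5 n
              + B * psi ^ r * central_conv (psi ^+ 6) 5 n).
  rewrite rmorph_sum !mulr_sumr -big_split; apply: eq_bigr => k _ /=.
  rewrite !rmorphM !rmorphXn /= binet (shift phi 6%N) // (shift psi 6%N) //.
  by rewrite /central_term -!exprM; ring.
rewrite hphi hpsi rmorphM rmorphXn rmorph_sum /= !mulr_sumr -big_split /=.
apply: eq_bigr => k _.
rewrite !rmorphM !rmorphXn /= binet (shift phi 2%N) // (shift psi 2%N) //.
by ring.
Qed.

Theorem theorem29 (r : int) (n : nat) :
  (\sum_(0 <= k < n.+1)
      'C(2 * k, k)%:Z * 'C(2 * (n - k), n - k)%:Z * 5 ^+ (n - k)
        * fib (6 * k%:Z + r)
   = 4 ^+ n * \sum_(0 <= k < n.+1)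
      'C(n, k)%:Z ^+ 2 * 4 ^+ k * fib (2 * k%:Z + r))
  /\
  (\sum_(0 <= k < n.+1)
      'C(2 * k, k)%:Z * 'C(2 * (n - k), n - k)%:Z * 5 ^+ (n - k)
        * lucas (6 * k%:Z + r)
   = 4 ^+ n * \sum_(0 <= k < n.+1)
      'C(n, k)%:Z ^+ 2 * 4 ^+ k * lucas (2 * k%:Z + r)).
Proof. by split; apply: recseq_central_conv. Qed.
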